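(* The maximal order type of the well-partial-ordering $\mathcal{T}(\mathcal{B}(\cdot))$ satisfies $o(\mathcal{T}(\mathcal{B}(\cdot)))\geq \vartheta(\varepsilon_{\Omega+1})$.
   Context: **Well-partial-orderings.** A well-partial-ordering (wpo) is a partial ordering $(X,\leq_X)$ such that for every infinite sequence $(x_i)_{i\ge 1}$ in $X$ there are $i<j$ with $x_i\leq_X x_j$. Its maximal order type $o(X)$ is the supremum of the order types of all well-orderings on the set $X$ that extend $\leq_X$. **Binary trees.** For a partial order $X$, $\mathcal{B}(X)$ is the set of finite structured (left/right ordered) binary trees with leaves labelled by elements of $X$ and unlabelled internal nodes (each internal node has exactly a left and a right immediate subtree). The ordering is tree embeddability: $B\le B'$ iff either $B,B'$ are single nodes with labels $x,x'$ and $x\leq_X x'$; or $B'$ has left and right immediate subtrees $B'_1,B'_2$ and ($B\le B'_1$, or $B\le B'_2$, or $B$ has left and right immediate subtrees $B_1,B_2$ with $B_1\le B'_1$ and $B_2\le B'_2$). **The ordering $\mathcal{T}(\mathcal{B}(\cdot))$.** $\mathcal{T}(\mathcal{B}(\cdot))$ is the least set such that $\circ\in\mathcal{T}(\mathcal{B}(\cdot))$, and whenever $B=B(t_1,\dots,t_n)$ is a finite structured binary tree whose leaf labels $t_1,\dots,t_n$ are in $\mathcal{T}(\mathcal{B}(\cdot))$, then the formal term $\circ[B(t_1,\dots,t_n)]$ is in $\mathcal{T}(\mathcal{B}(\cdot))$. Its ordering $\leq$ is the least reflexive and transitive relation such that: (1) $\circ\leq t$ for all $t$; (2) if $s\leq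 t_j$ for some $j$, then $s\leq\circ[B(t_1,\dots,t_n)]$; (3) if $B(t_1,\dots,t_n)\leq B'(t'_1,\dots,t'_m)$ in $\mathcal{B}(\mathcal{T}(\mathcal{B}(\cdot)),\leq)$, then $\circ[B(t_1,\dots,t_n)]\leq\circ[B'(t'_1,\dots,t'_m)]$. (It is known that $\mathcal{T}(\mathcal{B}(\cdot))$ is a wpo, so its maximal order type is defined.) **The function $\vartheta$.** $\Omega$ is the first uncountable ordinal and $\varepsilon_{\Omega+1}$ the first epsilon number above $\Omega$. Every $0<\alpha<\varepsilon_{\Omega+1}$ is uniquely $\alpha=\Omega^{\alpha_1}\beta_1+\dots+\Omega^{\alpha_n}\beta_n$ with $0<\beta_i<\Omega$ and $\alpha>\alpha_1>\dots>\alpha_n$; put $K(\alpha)=\{\beta_1,\dots,\beta_n\}\cup K(\alpha_1)\cup\dots\cup K(\alpha_n)$, $K(0)=\{0\}$, and $k(\alpha)=\max K(\alpha)$. Let $P=\{\omega^\alpha:\alpha\text{ an ordinal}\}$. For $\alpha<\varepsilon_{\Omega+1}$, $\vartheta(\alpha)=\min\{\zeta\in P: k(\alpha)<\zeta\text{ and }\forall\beta<\alpha\,(k(\beta)<\zeta\rightarrow\vartheta(\beta)<\zeta)\}$. With $\Omega_0[\alpha]=\alpha$, $\Omega_{n+1}[\alpha]=\Omega^{\Omega_n[\alpha]}$, the Howard-Bachmann ordinal is $\vartheta(\varepsilon_{\Omega+1}):=\sup_n\vartheta(\Omega_n[1])$. *)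

(* Defs.v *)
From Stdlib Require Import List Sorted Wellfounded ClassicalEpsilon.
Import ListNotations.

Set Implicit Arguments.
Unset Strict Implicit.

(* ------------------------------------------------------------------ *)
(** * Ordinals

    An ordinal is presented by a well-founded tree: [ssup f] is the strict
    supremum of the family [f], i.e. the least ordinal above all [f i].
    Different trees may present the same ordinal, so equality of ordinals is
    [oeq] and not Leibniz equality. *)

Inductive Ord : Type := ssup : forall D : Type, (D -> Ord) -> Ord.

Definition dom (a : Ord) : Type :=
  match a with @ssup D _ => D end.
Definition elt (a : Ord) : dom a -> Ord :=
  match a with @ssup D f => f end.

(** [ssup f <= b] means that [f i < b] for all [i], and [a < ssup g] means
    that [a <= g j] for some [j]. *)
Fixpoint ole (a b : Ord) : Prop :=
  match a with
  | @ssup D f => forall i : D,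
      match b with @ssup E g => exists j : E, ole (f i) (g j) end
  end.

Definition olt (a b : Ord) : Prop := exists j : dom b, ole a (elt j).

Definition oeq (a b : Ord) : Prop := ole a b /\ ole b a.

Declare Scope ord_scope.
Delimit Scope ord_scope with ord.
Bind Scope ord_scope with Ord.
Infix "<=" := ole : ord_scope.
Infix "<" := olt : ord_scope.
Infix "==" := oeq (at level 70, no associativity) : ord_scope.
Local Open Scope ord_scope.

Lemma ole_trans (a b c : Ord) : a <= b -> b <= c -> a <= c.
Proof.
revert b c; induction a as [I f IH]; intros [J g] [L h] Hab Hbc i; simpl in *.
destruct (Hab i) as [j Hj]; destruct (Hbc j) as [l Hl].
exists l; exact (IH i _ _ Hj Hl).
Qed.

Lemma olt_le_trans (a b c : Ord) : a < b -> b <= c -> a < c.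
Proof.
destruct b as [J g], c as [L h]; intros [j Hj] Hbc; simpl in *.
destruct (Hbc j) as [l Hl]; exists l; exact (ole_trans Hj Hl).
Qed.

Lemma olt_wf : well_founded olt.
Proof.
assert (H : forall a b, b <= a -> Acc olt b).
{ induction a as [I f IH]; intros b Hb; constructor; intros c Hc.
  destruct (olt_le_trans Hc Hb) as [i Hi]; exact (IH i c Hi). }
intros [I f]; constructor; intros c [i Hi]; exact (H _ _ Hi).
Qed.

Definition ozero : Ord := ssup (fun e : Empty_set => match e with end).
Definition osucc (a : Ord) : Ord := ssup (fun _ : unit => a).
Definition oone : Ord := osucc ozero.

(** Least upper bound of a family (not strict). *)
Definition osup (I : Type) (f : I -> Ord) : Ord :=
  ssup (fun p : {i : I & dom (f i)} => elt (projT2 p)).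

Fixpoint oadd (a b : Ord) : Ord :=
  match b with
  | @ssup E g => ssup (fun s : dom a + E =>
      match s with inl i => elt i | inr j => oadd a (g j) end)
  end.

Fixpoint omul (a b : Ord) : Ord :=
  match b with @ssup E g => osup (fun j : E => oadd (omul a (g j)) a) end.

(** [opow a b] is [a ^ b] for [a >= 1]; it is only used with base [omega] or
    [Omega]. *)
Fixpoint opow (a b : Ord) : Ord :=
  match b with
  | @ssup E g => osup (fun o : option E =>
      match o with None => oone | Some j => omul (opow a (g j)) a end)
  end.

Fixpoint ofin (n : nat) : Ord :=
  match n with O => ozero | S n => osucc (ofin n) end.

Definition omega : Ord := ssup ofin.

(** The least (resp. greatest) element of a class of ordinals, with an
    unspecified value if there is none. *)
Definition omin (A : Ord -> Prop) : Ord :=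
  epsilon (inhabits ozero) (fun a => A a /\ forall b, A b -> a <= b).

Definition omax (A : Ord -> Prop) : Ord :=
  epsilon (inhabits ozero) (fun a => A a /\ forall b, A b -> b <= a).

Definition ocountable (a : Ord) : Prop :=
  exists f : nat -> Ord, forall b, b < a -> exists n, f n == b.

Definition Omega : Ord := omin (fun a => ~ ocountable a).

(* ------------------------------------------------------------------ *)
(** * The function theta *)

(** A list [(a1, b1); ...; (an, bn)] of pairs (exponent, coefficient) stands
    for [Omega ^ a1 * b1 + ... + Omega ^ an * bn]. *)
Fixpoint Omega_sum (l : list (Ord * Ord)) : Ord :=
  match l with
  | [] => ozero
  | (a, b) :: l => oadd (omul (opow Omega a) b) (Omega_sum l)
  end.

Definition is_Omega_nf (a : Ord) (l : list (Ord * Ord)) : Prop :=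
  a == Omega_sum l /\
  Forall (fun p => ozero < snd p /\ snd p < Omega) l /\
  Sorted (fun x y => y < x) (a :: map fst l).

(** [inK a b] means that [b] belongs to the set [K a]. *)
Inductive inK : Ord -> Ord -> Prop :=
| inK_zero a b : a == ozero -> b == ozero -> inK a b
| inK_coef a l e c b : is_Omega_nf a l -> In (e, c) l -> b == c -> inK a b
| inK_exp a l e c b : is_Omega_nf a l -> In (e, c) l -> inK e b -> inK a b.

Definition maxK (a : Ord) : Ord := omax (inK a).

Definition omega_power (z : Ord) : Prop := exists a, z == opow omega a.

(** Recursion along [olt] gives a total function; only its values below
    [epsilon_(Omega+1)] are meaningful, and these only depend on one
    another. *)
Definition theta : Ord -> Ord :=
  Fix olt_wf (fun _ => Ord) (fun a theta_below =>
    omin (fun z =>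
      omega_power z /\ maxK a < z /\
      forall (b : Ord) (ltba : b < a), maxK b < z -> theta_below b ltba < z)).

Fixpoint Omega_tower (n : nat) (a : Ord) : Ord :=
  match n with O => a | S n => opow Omega (Omega_tower n a) end.

Definition Howard_Bachmann : Ord :=
  osup (fun n : nat => theta (Omega_tower n oone)).

(* ------------------------------------------------------------------ *)
(** * Order types and maximal order types *)

Definition strict (X : Type) (R : X -> X -> Prop) (x y : X) : Prop :=
  R x y /\ x <> y.

Record well_ordering (X : Type) (R : X -> X -> Prop) : Prop := {
  wo_refl : forall x, R x x;
  wo_antisym : forall x y, R x y -> R y x -> x = y;
  wo_trans : forall x y z, R x y -> R y z -> R x z;
  wo_total : forall x y, R x y \/ R y x;
  wo_wf : well_founded (strict R)
}.

(** The order type of the initial segment strictly below a point. *)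
Definition rank (X : Type) (R : X -> X -> Prop) (wf : well_founded R) :
  X -> Ord :=
  Fix wf (fun _ => Ord) (fun x rank_below =>
    ssup (fun y : {y : X | R y x} =>
      rank_below (proj1_sig y) (proj2_sig y))).

Definition order_type (X : Type) (R : X -> X -> Prop) (wo : well_ordering R) :
  Ord := ssup (rank (wo_wf wo)).

Definition extends (X : Type) (R le : X -> X -> Prop) : Prop :=
  forall x y, le x y -> R x y.

Definition max_order_type (X : Type) (le : X -> X -> Prop) : Ord :=
  osup (fun R : {R : X -> X -> Prop | well_ordering R /\ extends R le} =>
    order_type (proj1 (proj2_sig R))).

(* ------------------------------------------------------------------ *)
(** * Binary trees and the ordering T(B(.)) *)

Inductive btree (X : Type) : Type :=
| leaf : X -> btree X
| node : btree X -> btree X -> btree X.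

Inductive is_label (X : Type) (x : X) : btree X -> Prop :=
| is_label_leaf : is_label x (leaf x)
| is_label_left B1 B2 : is_label x B1 -> is_label x (node B1 B2)
| is_label_right B1 B2 : is_label x B2 -> is_label x (node B1 B2).

Inductive btree_le (X : Type) (le : X -> X -> Prop) :
  btree X -> btree X -> Prop :=
| btree_le_leaf x x' : le x x' -> btree_le le (leaf x) (leaf x')
| btree_le_left B B1' B2' :
    btree_le le B B1' -> btree_le le B (node B1' B2')
| btree_le_right B B1' B2' :
    btree_le le B B2' -> btree_le le B (node B1' B2')
| btree_le_node B1 B2 B1' B2' :
    btree_le le B1 B1' -> btree_le le B2 B2' ->
    btree_le le (node B1 B2) (node B1' B2').

Inductive TB : Type :=
| circ : TB
| circ_app : btree TB -> TB.

Inductive TB_le : TB -> TB -> Prop :=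
| TB_le_refl t : TB_le t t
| TB_le_trans s t u : TB_le s t -> TB_le t u -> TB_le s u
| TB_le_circ t : TB_le circ t
| TB_le_label s t B : is_label t B -> TB_le s t -> TB_le s (circ_app B)
| TB_le_app B B' :
    btree_le TB_le B B' -> TB_le (circ_app B) (circ_app B').

(* Main.v *)
(** Ordinals are assigned to terms by a collapse [collapse B] of labelled trees
    that imitates [theta] but omits the restriction to powers of [omega]: it is
    the least [z] above the labels of [B] and above [collapse B'] for all [B']
    of smaller value with labels below [z], where the value of a tree is given
    by [node B1 B2 |-> Omega ^ B1 + B2].  Reading labels recursively, this
    valuation is monotone for the ordering of T(B(.)), so refining it by an
    injective monotone code in [nat] yields a well-ordering extending that
    ordering.

    Let [gap] be the least ordinal that is not the value of a term; it is
    countable since there are countably many terms.  A minimality argument shows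
    that trees with labels below [gap] have collapse below [gap], and the
    well-ordering above has length at least [gap].  Finally, ordinals
    [b < epsilon_(Omega+1)] are coded by trees whose labels are the coefficients
    in [K b], in an order-preserving way; induction on [b] gives
    [theta b <= collapse B] for the code [B] of [b], hence
    [theta (Omega_n[1]) < gap]. *)

From Stdlib Require Import List Sorted Wellfounded Arith Lia Cantor.
From Stdlib Require Import ClassicalEpsilon FunctionalExtensionality.
Require Import Defs.

Set Implicit Arguments.
Unset Strict Implicit.

Local Open Scope ord_scope.

(** * Order and arithmetic of ordinals *)

Lemma ole_refl (a : Ord) : a <= a.
Proof. induction a as [D f IH]; intros i; exists i; apply IH. Qed.

Lemma ole_intro (a b : Ord) : (forall i : dom a, elt i < b) -> a <= b.
Proof. destruct a, b; exact (fun H => H). Qed.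

Lemma elt_lt (a : Ord) (i : dom a) : elt i < a.
Proof. exists i; apply ole_refl. Qed.

Lemma ole_lt_trans (a b c : Ord) : a <= b -> b < c -> a < c.
Proof. intros Hab [j Hj]; exists j; exact (ole_trans Hab Hj). Qed.

Lemma elt_le (a : Ord) (i : dom a) : elt i <= a.
Proof.
revert i; induction a as [D f IH]; intros i; simpl in *.
apply ole_intro; intros k; exists i; apply IH.
Qed.

Lemma olt_le (a b : Ord) : a < b -> a <= b.
Proof. intros [j Hj]; exact (ole_trans Hj (elt_le j)). Qed.

Lemma olt_trans (a b c : Ord) : a < b -> b < c -> a < c.
Proof. intros Hab Hbc; exact (ole_lt_trans (olt_le Hab) Hbc). Qed.

Lemma olt_irrefl (a : Ord) : ~ a < a.
Proof.
induction a as [D f IH]; intros [i Hi]; apply (IH i).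
exact (olt_le_trans (@elt_lt (ssup f) i) Hi).
Qed.

Lemma ole_not_lt (a b : Ord) : a <= b -> ~ b < a.
Proof. intros H1 H2; exact (olt_irrefl (ole_lt_trans H1 H2)). Qed.

Lemma ole_or_lt (a b : Ord) : a <= b \/ b < a.
Proof.
revert b; induction a as [D f IH]; intros b.
destruct (classic (forall i, f i < b)) as [H|H]; [left; now apply ole_intro|].
apply not_all_ex_not in H; destruct H as [i Hi]; right; exists i; simpl.
apply ole_intro; intros j; destruct (IH i (elt j)) as [Hj|Hj]; [|exact Hj].
destruct Hi; now exists j.
Qed.

Lemma not_ole_lt (a b : Ord) : ~ a <= b -> b < a.
Proof. destruct (ole_or_lt a b); tauto. Qed.

Lemma not_olt_le (a b : Ord) : ~ a < b -> b <= a.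
Proof. destruct (ole_or_lt b a); tauto. Qed.

Lemma ole_of_lt (a b : Ord) : (forall c, c < a -> c < b) -> a <= b.
Proof. intros H; apply ole_intro; intros i; apply H, elt_lt. Qed.

Lemma oeq_refl (a : Ord) : a == a.
Proof. split; apply ole_refl. Qed.

Lemma oeq_sym (a b : Ord) : a == b -> b == a.
Proof. intros []; now split. Qed.

Lemma oeq_trans (a b c : Ord) : a == b -> b == c -> a == c.
Proof. intros [? ?] [? ?]; split; eauto using ole_trans. Qed.

Lemma olt_or_oeq_or_gt (a b : Ord) : a < b \/ a == b \/ b < a.
Proof.
destruct (ole_or_lt a b) as [H|H]; [|tauto].
destruct (ole_or_lt b a) as [H'|H']; [right; left; now split|tauto].
Qed.

Lemma olt_ind (P : Ord -> Prop) :
  (forall a, (forall b, b < a -> P b) -> P a) -> forall a, P a.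
Proof. intros H a; exact (well_founded_ind olt_wf P H a). Qed.

Lemma least_ordinal (A : Ord -> Prop) (a : Ord) :
  A a -> exists b, A b /\ forall c, A c -> b <= c.
Proof.
induction a as [a IH] using olt_ind; intros Ha.
destruct (classic (exists b, b < a /\ A b)) as [[b [Hb Ab]]|H]; [eauto|].
exists a; split; [exact Ha|]; intros c Hc; apply not_olt_le; eauto.
Qed.

Lemma omin_spec (A : Ord -> Prop) (a : Ord) :
  A a -> A (omin A) /\ forall b, A b -> omin A <= b.
Proof. intros Ha; exact (epsilon_spec _ _ (least_ordinal Ha)). Qed.

Lemma omin_le (A : Ord -> Prop) (a : Ord) : A a -> omin A <= a.
Proof. intros Ha; exact (proj2 (omin_spec Ha) a Ha). Qed.

Lemma ozero_le (a : Ord) : ozero <= a.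
Proof. apply ole_intro; intros []. Qed.

Lemma not_olt_ozero (a : Ord) : ~ a < ozero.
Proof. intros [[] _]. Qed.

Lemma osucc_gt (a : Ord) : a < osucc a.
Proof. exists tt; apply ole_refl. Qed.

Lemma osucc_le (a b : Ord) : a < b -> osucc a <= b.
Proof. intros H; apply ole_intro; now intros []. Qed.

Lemma olt_osucc (a b : Ord) : a < osucc b -> a <= b.
Proof. now intros [[] H]. Qed.

Lemma oone_le (a : Ord) : ozero < a -> oone <= a.
Proof. apply osucc_le. Qed.

Lemma osup_ge (I : Type) (f : I -> Ord) (i : I) : f i <= osup f.
Proof.
apply ole_intro; intros k.
exists (existT (fun i => dom (f i)) i k); apply ole_refl.
Qed.

Lemma olt_osup (I : Type) (f : I -> Ord) (c : Ord) :
  c < osup f -> exists i, c < f i.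
Proof. intros [[i k] H]; exists i, k; exact H. Qed.

Lemma osup_le (I : Type) (f : I -> Ord) (b : Ord) :
  (forall i, f i <= b) -> osup f <= b.
Proof.
intros H; apply ole_of_lt; intros c Hc; apply olt_osup in Hc.
destruct Hc as [i Hi]; exact (olt_le_trans Hi (H i)).
Qed.

(** * Ordinal addition, multiplication and exponentiation *)

Lemma oadd_ge_l (a b : Ord) : a <= oadd a b.
Proof.
destruct b as [E g]; apply ole_intro; intros i.
exists (inl i); apply ole_refl.
Qed.

Lemma oadd_mono (a a' b b' : Ord) :
  a <= a' -> b <= b' -> oadd a b <= oadd a' b'.
Proof.
intros Ha; revert b'; induction b as [E g IH]; intros b' Hb.
apply ole_intro; intros [i|j]; simpl.
- exact (olt_le_trans (elt_lt i) (ole_trans Ha (oadd_ge_l _ _))).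
- destruct (olt_le_trans (@elt_lt (ssup g) j) Hb) as [k Hk].
  destruct b' as [E' g']; exists (inr k); apply IH, Hk.
Qed.

Lemma oadd_lt_mono_r (a b b' : Ord) : b < b' -> oadd a b < oadd a b'.
Proof.
destruct b' as [E' g']; intros [k Hk]; exists (inr k).
exact (oadd_mono (ole_refl a) Hk).
Qed.

Lemma olt_oadd (a b c : Ord) :
  c < oadd a b -> c < a \/ exists d, d < b /\ c <= oadd a d.
Proof.
destruct b as [E g]; intros [[i|j] H].
- left; now exists i.
- right; exists (g j); split; [exact (@elt_lt (ssup g) j)|exact H].
Qed.

Lemma oadd_ge_r (a b : Ord) : b <= oadd a b.
Proof.
induction b as [E g IH]; apply ole_intro; intros j.
exists (inr j); apply IH.
Qed.

Lemma oadd_zero (a : Ord) : oadd a ozero <= a.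
Proof.
apply ole_of_lt; intros c Hc; destruct (olt_oadd Hc) as [H|[d [H _]]]; auto.
destruct (not_olt_ozero H).
Qed.

(** Left subtraction: the least [r] with [b <= oadd a r] does not overshoot, since [oadd a d < b]
    for every [d < r]. *)
Lemma oadd_diff (a b : Ord) : a <= b -> exists r, b == oadd a r.
Proof.
intros Hab.
destruct (@least_ordinal (fun r => b <= oadd a r) b) as [r [Hr Hmin]];
  [apply oadd_ge_r|].
exists r; split; [exact Hr|].
apply ole_of_lt; intros c Hc; destruct (olt_oadd Hc) as [H|[d [Hd H]]].
- exact (olt_le_trans H Hab).
- apply (ole_lt_trans H), not_ole_lt; intros Hbd.
  exact (ole_not_lt (Hmin d Hbd) Hd).
Qed.

Lemma omul_mono (a a' b b' : Ord) :
  a <= a' -> b <= b' -> omul a b <= omul a' b'.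
Proof.
intros Ha; revert b'; induction b as [E g IH]; intros b' Hb.
apply osup_le; intros j.
destruct (olt_le_trans (@elt_lt (ssup g) j) Hb) as [k Hk].
destruct b' as [E' g']; simpl in *.
apply ole_trans with (oadd (omul a' (g' k)) a').
- apply oadd_mono; auto.
- exact (osup_ge (fun k => oadd (omul a' (g' k)) a') k).
Qed.

Lemma omul_step (a b c : Ord) : b < c -> oadd (omul a b) a <= omul a c.
Proof.
destruct c as [E g]; intros [j Hj]; simpl in *.
apply ole_trans with (oadd (omul a (g j)) a).
- apply oadd_mono; [apply omul_mono|]; auto using ole_refl.
- exact (osup_ge (fun j => oadd (omul a (g j)) a) j).
Qed.

Lemma olt_omul (a b c : Ord) :
  c < omul a b -> exists d, d < b /\ c < oadd (omul a d) a.
Proof.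
destruct b as [E g]; intros H; destruct (olt_osup H) as [j Hj].
exists (g j); split; [exact (@elt_lt (ssup g) j)|exact Hj].
Qed.

Lemma omul_one_ge (a : Ord) : a <= omul a oone.
Proof. exact (ole_trans (oadd_ge_r _ _) (omul_step a (osucc_gt ozero))). Qed.

Lemma ozero_oadd (a : Ord) : oadd ozero a <= a.
Proof.
induction a as [E g IH]; apply ole_intro; intros [[]|j].
exists j; apply IH.
Qed.

Lemma omul_one_le (a : Ord) : omul a oone <= a.
Proof.
apply ole_of_lt; intros c Hc; destruct (olt_omul Hc) as [d [Hd H]].
apply (olt_le_trans H); apply ole_trans with (oadd ozero a); [|apply ozero_oadd].
apply oadd_mono; [|apply ole_refl].
apply ole_of_lt; intros x Hx; destruct (olt_omul Hx) as [y [Hy _]].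
destruct (not_olt_ozero (olt_le_trans Hy (olt_osucc Hd))).
Qed.

Lemma omul_pos (a b : Ord) : ozero < b -> a <= omul a b.
Proof.
intros Hb; apply (ole_trans (omul_one_ge a)).
apply omul_mono; [apply ole_refl|now apply oone_le].
Qed.

Lemma oone_le_opow (a b : Ord) : oone <= opow a b.
Proof.
destruct b as [E g].
exact (osup_ge (fun o : option E =>
  match o with None => oone | Some j => omul (opow a (g j)) a end) None).
Qed.

Lemma opow_pos (a b : Ord) : ozero < opow a b.
Proof. exact (olt_le_trans (osucc_gt _) (oone_le_opow a b)). Qed.

Lemma opow_elt (a : Ord) (E : Type) (g : E -> Ord) (j : E) :
  omul (opow a (g j)) a <= opow a (ssup g).
Proof.
exact (osup_ge (fun o : option E =>
  match o with None => oone | Some j => omul (opow a (g j)) a end) (Some j)).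
Qed.

Lemma opow_mono (a b b' : Ord) : b <= b' -> opow a b <= opow a b'.
Proof.
revert b'; induction b as [E g IH]; intros b' Hb.
apply osup_le; intros [j|]; [|apply oone_le_opow].
destruct (olt_le_trans (@elt_lt (ssup g) j) Hb) as [k Hk].
destruct b' as [E' g']; simpl in Hk.
refine (ole_trans _ (opow_elt a g' k)).
apply omul_mono; [now apply IH|apply ole_refl].
Qed.

Lemma opow_step (a b c : Ord) : b < c -> omul (opow a b) a <= opow a c.
Proof.
destruct c as [E g]; intros [j Hj]; refine (ole_trans _ (opow_elt a g j)).
apply omul_mono; [now apply opow_mono|apply ole_refl].
Qed.

Lemma olt_opow (a b c : Ord) :
  c < opow a b -> c < oone \/ exists d, d < b /\ c < omul (opow a d) a.
Proof.
destruct b as [E g]; intros H; apply olt_osup in H; destruct H as [[j|] H].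
- right; exists (g j); split; [exact (@elt_lt (ssup g) j)|exact H].
- now left.
Qed.

Section Exponentiation.

Variable w : Ord.
Hypothesis w_gt1 : oone < w.

Lemma opow_add_lt (a c : Ord) :
  c < opow w a -> oadd (opow w a) c < omul (opow w a) w.
Proof.
intros Hc; apply (olt_le_trans (oadd_lt_mono_r _ Hc)).
apply ole_trans with (oadd (omul (opow w a) oone) (opow w a)).
- apply oadd_mono; [apply omul_one_ge|apply ole_refl].
- now apply omul_step.
Qed.

Lemma opow_lt (a b : Ord) : a < b -> opow w a < opow w b.
Proof.
intros Hab; refine (olt_le_trans _ (opow_step _ Hab)).
exact (ole_lt_trans (oadd_ge_l _ ozero) (opow_add_lt (opow_pos w a))).
Qed.

Lemma opow_lt_inv (a b : Ord) : opow w a < opow w b -> a < b.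
Proof.
intros H; apply not_ole_lt; intros Hba.
exact (ole_not_lt (opow_mono w Hba) H).
Qed.

Lemma opow_ge (a : Ord) : a <= opow w a.
Proof.
induction a as [E g IH]; apply ole_intro; intros j.
exact (ole_lt_trans (IH j) (opow_lt (@elt_lt (ssup g) j))).
Qed.

End Exponentiation.

Lemma oone_lt_omega : oone < omega.
Proof. exists 1%nat; apply ole_refl. Qed.

(** Take the least [a] with [z <= omega ^ a]. If [z] were smaller than this power, it would lie
    below some finite multiple of [omega ^ d < z], but closure under addition keeps all these
    multiples below [z]. *)
Lemma additively_closed_omega_power (z : Ord) :
  ozero < z -> (forall c d, c < z -> d < z -> oadd c d < z) -> omega_power z.
Proof.
intros Hz Hadd.
destruct (@least_ordinal (fun a => z <= opow omega a) z) as [a [Ha Hmin]];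
  [exact (opow_ge oone_lt_omega z)|].
exists a; split; [exact Ha|]; apply not_olt_le; intros Hlt.
destruct (olt_opow Hlt) as [H|[d [Hd H]]].
{ exact (ole_not_lt (oone_le Hz) H). }
assert (Hpow : opow omega d < z).
{ apply not_ole_lt; intros H'; exact (ole_not_lt (Hmin d H') Hd). }
assert (Hmul : forall n, omul (opow omega d) (ofin n) < z).
{ induction n as [|n IHn].
  - refine (ole_lt_trans _ Hz); apply osup_le; intros [].
  - apply (@ole_lt_trans _ (oadd (omul (opow omega d) (ofin n)) (opow omega d)));
      [|now apply Hadd].
    apply osup_le; intros _; apply ole_refl. }
destruct (olt_omul H) as [e [[n Hn] He]].
apply (olt_irrefl (a := z)), (olt_trans He).
refine (ole_lt_trans _ (Hmul (S n))).
apply omul_step, (ole_lt_trans Hn), osucc_gt.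
Qed.

(** * Ranks in a well-founded relation *)

Lemma rank_eq (X : Type) (R : X -> X -> Prop) (wf : well_founded R) (x : X) :
  rank wf x = ssup (fun y : {y : X | R y x} => rank wf (proj1_sig y)).
Proof.
unfold rank at 1; rewrite Fix_eq; [reflexivity|].
intros y f g H; f_equal; apply functional_extensionality; intros [z Hz]; apply H.
Qed.

Lemma rank_lt (X : Type) (R : X -> X -> Prop) (wf : well_founded R) (x y : X) :
  R y x -> rank wf y < rank wf x.
Proof.
intros H; rewrite (rank_eq wf x).
exact (@elt_lt (ssup (fun y : {y : X | R y x} => rank wf (proj1_sig y)))
  (exist _ y H)).
Qed.

(** * The first uncountable ordinal *)

(* The strict supremum of the order types of all well-founded relations on
   [nat]: an enumeration of the ordinals below it would itself induce such a
   relation of at least this length. *)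
Lemma uncountable_ordinal : exists a, ~ ocountable a.
Proof.
pose (X := ssup (fun R : {R : nat -> nat -> Prop | well_founded R} =>
  ssup (rank (proj2_sig R)))).
exists X; intros [f Hf].
pose (R := fun m n => f m < f n).
assert (wf : well_founded R) by exact (wf_inverse_image _ _ olt f olt_wf).
assert (Hrank : forall a, a < X -> forall n, f n == a -> a <= rank wf n).
{ induction a as [a IH] using olt_ind; intros HaX n Hn.
  apply ole_of_lt; intros c Hc.
  assert (HcX : c < X) by exact (olt_trans Hc HaX).
  destruct (Hf c HcX) as [m Hm].
  apply (ole_lt_trans (IH c Hc HcX m Hm)), rank_lt.
  exact (ole_lt_trans (proj1 Hm) (olt_le_trans Hc (proj2 Hn))). }
apply (@olt_irrefl X).
exists (exist _ R wf).
refine (@ole_of_lt X (ssup (rank wf)) _); intros c Hc; destruct (Hf c Hc) as [n Hn].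
exists n; exact (Hrank c Hc n Hn).
Qed.

Lemma ocountable_le (a b : Ord) : a <= b -> ocountable b -> ocountable a.
Proof.
intros Hab [f Hf]; exists f; intros c Hc; exact (Hf c (olt_le_trans Hc Hab)).
Qed.

Lemma Omega_uncountable : ~ ocountable Omega.
Proof.
destruct uncountable_ordinal as [a Ha].
exact (proj1 (omin_spec (A := fun a => ~ ocountable a) Ha)).
Qed.

Lemma lt_Omega_countable (a : Ord) : a < Omega -> ocountable a.
Proof.
destruct uncountable_ordinal as [b Hb]; intros Ha; apply NNPP; intros Hn.
exact (ole_not_lt
  (proj2 (omin_spec (A := fun a => ~ ocountable a) Hb) a Hn) Ha).
Qed.

Lemma countable_lt_Omega (a : Ord) : ocountable a -> a < Omega.
Proof.
intros Ha; apply not_ole_lt; intros H.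
exact (Omega_uncountable (ocountable_le H Ha)).
Qed.

Lemma osucc_lt_Omega (a : Ord) : a < Omega -> osucc a < Omega.
Proof.
intros Ha; apply countable_lt_Omega.
destruct (lt_Omega_countable Ha) as [f Hf].
exists (fun n => match n with O => a | S n => f n end); intros b Hb.
destruct (olt_or_oeq_or_gt a b) as [H|[H|H]].
- destruct (ole_not_lt (olt_osucc Hb) H).
- now exists O.
- destruct (Hf b H) as [n Hn]; now exists (S n).
Qed.

Lemma ozero_lt_Omega : ozero < Omega.
Proof.
apply countable_lt_Omega; exists (fun _ => ozero); intros b Hb.
destruct (not_olt_ozero Hb).
Qed.

Lemma oone_lt_Omega : oone < Omega.
Proof. exact (osucc_lt_Omega ozero_lt_Omega). Qed.

Lemma opow_Omega_add_lt (a b c : Ord) :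
  c < opow Omega a -> a < b -> oadd (opow Omega a) c < opow Omega b.
Proof.
intros Hc Hab.
exact (olt_le_trans (opow_add_lt oone_lt_Omega Hc) (opow_step _ Hab)).
Qed.

(** * Values of labelled trees and their collapse *)

(* Tree embeddings only increase this value: plain ordinal addition suffices,
   since weak monotonicity in both subtrees is enough. *)
Fixpoint tree_val (B : btree Ord) : Ord :=
  match B with
  | leaf x => x
  | node B1 B2 => oadd (opow Omega (tree_val B1)) (tree_val B2)
  end.

Lemma btree_le_tree_val (B B' : btree Ord) :
  btree_le ole B B' -> tree_val B <= tree_val B'.
Proof.
induction 1 as [x y H|B B1 B2 _ IH|B B1 B2 _ IH|B1 B2 B1' B2' _ IH1 _ IH2]; simpl.
- exact H.
- apply (ole_trans IH), (ole_trans (opow_ge oone_lt_Omega _)), oadd_ge_l.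
- exact (ole_trans IH (oadd_ge_r _ _)).
- apply oadd_mono; [now apply opow_mono|exact IH2].
Qed.

Lemma btree_le_label (B B' : btree Ord) (x : Ord) :
  btree_le ole B B' -> is_label x B -> exists y, is_label y B' /\ x <= y.
Proof.
induction 1 as [u v H|B B1 B2 _ IH|B B1 B2 _ IH|B1 B2 B1' B2' _ IH1 _ IH2];
  intros Hx.
- exists v; inversion Hx; subst; split; [constructor|exact H].
- destruct (IH Hx) as [y [Hy Hxy]]; exists y; split; [now constructor|exact Hxy].
- destruct (IH Hx) as [y [Hy Hxy]]; exists y; split; [now constructor|exact Hxy].
- inversion Hx; subst; [destruct IH1 as [y [Hy Hxy]]|destruct IH2 as [y [Hy Hxy]]];
    trivial; exists y; (split; [now constructor|exact Hxy]).
Qed.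

Definition labels_below (B : btree Ord) (z : Ord) : Prop :=
  forall x, is_label x B -> x < z.

Definition tree_lt (B B' : btree Ord) : Prop := tree_val B < tree_val B'.

Lemma tree_lt_wf : well_founded tree_lt.
Proof. exact (wf_inverse_image _ _ olt tree_val olt_wf). Qed.

(* The analogue of [theta] for trees, with all ordinals below [Omega] as
   possible values instead of the powers of [omega] only.  The disjunct
   [Omega <= z] makes the minimum exist without any cardinality argument. *)
Definition collapse : btree Ord -> Ord :=
  Fix tree_lt_wf (fun _ => Ord) (fun B collapse_below =>
    omin (fun z => Omega <= z \/
      (labels_below B z /\
       forall (B' : btree Ord) (lt : tree_lt B' B), labels_below B' z ->
         collapse_below B' lt < z))).

Definition collapse_bound (B : btree Ord) (z : Ord) : Prop :=
  labels_below B z /\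
  forall B', tree_lt B' B -> labels_below B' z -> collapse B' < z.

Lemma collapse_eq (B : btree Ord) :
  collapse B = omin (fun z => Omega <= z \/ collapse_bound B z).
Proof.
unfold collapse at 1; rewrite Fix_eq; [reflexivity|].
intros C f g H; replace g with f; [reflexivity|].
apply functional_extensionality_dep; intros y.
apply functional_extensionality_dep; intros p; apply H.
Qed.

Lemma collapse_spec (B : btree Ord) :
  (Omega <= collapse B \/ collapse_bound B (collapse B)) /\
  forall z, Omega <= z \/ collapse_bound B z -> collapse B <= z.
Proof.
rewrite collapse_eq.
exact (omin_spec (A := fun z => Omega <= z \/ collapse_bound B z)
  (or_introl (ole_refl Omega))).
Qed.

Lemma collapse_le_Omega (B : btree Ord) : collapse B <= Omega.
Proof. apply collapse_spec; left; apply ole_refl. Qed.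

Lemma collapse_le (B : btree Ord) (z : Ord) :
  collapse_bound B z -> collapse B <= z.
Proof. intros H; apply collapse_spec; now right. Qed.

Lemma collapse_is_bound (B : btree Ord) :
  collapse B < Omega -> collapse_bound B (collapse B).
Proof.
intros H; destruct (collapse_spec B) as [[H'|H'] _]; [|exact H'].
destruct (ole_not_lt H' H).
Qed.

(** Unless it reaches [Omega], [collapse B'] meets the conditions defining [collapse B]: each label
    of [B] is at most one of [B'], and a tree of value smaller than that of [B] also has value
    smaller than that of [B']. *)
Lemma collapse_mono (B B' : btree Ord) :
  btree_le ole B B' -> collapse B <= collapse B'.
Proof.
intros H; destruct (collapse_spec B') as [[H'|[Hlab Hlt]] _].
{ exact (ole_trans (collapse_le_Omega B) H'). }
assert (HB : labels_below B (collapse B')).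
{ intros x Hx; destruct (btree_le_label H Hx) as [y [Hy Hxy]].
  exact (ole_lt_trans Hxy (Hlab y Hy)). }
apply collapse_le; split; [exact HB|]; intros C HC.
apply Hlt, (olt_le_trans HC), btree_le_tree_val, H.
Qed.

(** * A monotone valuation of T(B(.)) *)

Fixpoint btree_map (X Y : Type) (f : X -> Y) (B : btree X) : btree Y :=
  match B with
  | leaf x => leaf (f x)
  | node B1 B2 => node (btree_map f B1) (btree_map f B2)
  end.

Lemma is_label_map (X Y : Type) (f : X -> Y) (B : btree X) (x : X) :
  is_label x B -> is_label (f x) (btree_map f B).
Proof. induction 1; simpl; now constructor. Qed.

Lemma btree_le_map (X Y : Type) (R : X -> X -> Prop) (S : Y -> Y -> Prop)
  (f : X -> Y) (fmono : forall x y, R x y -> S (f x) (f y)) (B B' : btree X) :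
  btree_le R B B' -> btree_le S (btree_map f B) (btree_map f B').
Proof. induction 1; simpl; auto using btree_le. Qed.

(** Kept transparent by [Defined]: the fixpoint in [TB_le_nested_ind] recurses through it, and its
    termination check must see that the calls are on subproofs. *)
Lemma btree_le_sub (X : Type) (R S : X -> X -> Prop)
  (sub : forall x y, R x y -> S x y) (B B' : btree X) :
  btree_le R B B' -> btree_le S B B'.
Proof.
revert B B'.
exact (fix F B B' (H : btree_le R B B') : btree_le S B B' :=
  match H with
  | btree_le_leaf h => btree_le_leaf (sub _ _ h)
  | btree_le_left _ h => btree_le_left _ (F _ _ h)
  | btree_le_right _ h => btree_le_right _ (F _ _ h)
  | btree_le_node h1 h2 => btree_le_node (F _ _ h1) (F _ _ h2)
  end).
Defined.

(* The induction principle generated for [TB_le] has no hypothesis for the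
   pairs of labels compared inside [TB_le_app]. *)
Lemma TB_le_nested_ind (P : TB -> TB -> Prop)
  (Hrefl : forall t, P t t)
  (Htrans : forall s t u, P s t -> P t u -> P s u)
  (Hcirc : forall t, P circ t)
  (Hlabel : forall s t B, is_label t B -> P s t -> P s (circ_app B))
  (Happ : forall B B', btree_le P B B' -> P (circ_app B) (circ_app B'))
  (s t : TB) : TB_le s t -> P s t.
Proof.
revert s t.
exact (fix F s t (H : TB_le s t) : P s t :=
  match H with
  | TB_le_refl t => Hrefl t
  | TB_le_trans h1 h2 => Htrans _ _ _ (F _ _ h1) (F _ _ h2)
  | TB_le_circ t => Hcirc t
  | TB_le_label l h => Hlabel _ _ _ l (F _ _ h)
  | TB_le_app h => Happ _ _ (btree_le_sub F h)
  end).
Qed.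

Fixpoint TB_val (t : TB) : Ord :=
  match t with
  | circ => ozero
  | circ_app B => collapse (btree_map TB_val B)
  end.

Lemma TB_val_le_Omega (t : TB) : TB_val t <= Omega.
Proof. destruct t; [apply ozero_le|apply collapse_le_Omega]. Qed.

Lemma TB_val_mono (s t : TB) : TB_le s t -> TB_val s <= TB_val t.
Proof.
revert s t; apply TB_le_nested_ind; simpl.
- intros; apply ole_refl.
- eauto using ole_trans.
- intros; apply ozero_le.
- intros s t B Ht Hst; apply (ole_trans Hst).
  destruct (collapse_spec (btree_map TB_val B)) as [[H|[H _]] _].
  (* If the collapse is at least [Omega], the common bound [Omega] on all values suffices. *)
  + exact (ole_trans (TB_val_le_Omega t) H).
  + apply olt_le, H, is_label_map, Ht.
- intros B B' H; apply collapse_mono.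
  exact (btree_le_map (R := fun s t => TB_val s <= TB_val t)
    (S := ole) (f := TB_val) (fun _ _ h => h) H).
Qed.

(** * An injective monotone code of terms by natural numbers *)

(** Cantor pairing, monotone in both components and at least as large as each. The first component
    is 0 for leaves and a successor for nodes, so the two never share a code. *)
Fixpoint btree_code (B : btree nat) : nat :=
  match B with
  | leaf n => to_nat (0, n)
  | node B1 B2 => to_nat (S (btree_code B1), btree_code B2)
  end.

Fixpoint TB_code (t : TB) : nat :=
  match t with
  | circ => 0
  | circ_app B => S (btree_code (btree_map TB_code B))
  end.

Lemma to_nat_mono (x y x' y' : nat) :
  (x <= x' -> y <= y' -> to_nat (x, y) <= to_nat (x', y'))%nat.
Proof.
intros Hx Hy.
pose proof (to_nat_spec x y); pose proof (to_nat_spec x' y'); nia.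
Qed.

Lemma btree_code_label (B : btree nat) (n : nat) :
  is_label n B -> (n <= btree_code B)%nat.
Proof.
induction 1 as [|B1 B2 _ IH|B1 B2 _ IH]; cbn [btree_code].
- pose proof (to_nat_non_decreasing 0 n); lia.
- pose proof (to_nat_non_decreasing (S (btree_code B1)) (btree_code B2)); lia.
- pose proof (to_nat_non_decreasing (S (btree_code B1)) (btree_code B2)); lia.
Qed.

Lemma btree_code_mono (B B' : btree nat) :
  btree_le le B B' -> (btree_code B <= btree_code B')%nat.
Proof.
induction 1 as [x y H|B B1 B2 _ IH|B B1 B2 _ IH|B1 B2 B1' B2' _ IH1 _ IH2];
  cbn [btree_code].
- now apply to_nat_mono.
- pose proof (to_nat_non_decreasing (S (btree_code B1)) (btree_code B2)); lia.
- pose proof (to_nat_non_decreasing (S (btree_code B1)) (btree_code B2)); lia.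
- apply to_nat_mono; lia.
Qed.

Lemma TB_code_mono (s t : TB) : TB_le s t -> (TB_code s <= TB_code t)%nat.
Proof.
revert s t; apply TB_le_nested_ind; simpl; try lia.
- intros s t B Ht Hst.
  pose proof (btree_code_label (is_label_map TB_code Ht)); lia.
- intros B B' H; apply le_n_S, btree_code_mono.
  exact (btree_le_map (R := fun s t => (TB_code s <= TB_code t)%nat)
    (S := le) (f := TB_code)
    (fun _ _ h => h) H).
Qed.

Lemma TB_code_inj (s t : TB) : TB_code s = TB_code t -> s = t.
Proof.
revert s t.
refine (fix F s {struct s} := _); intros t; destruct s as [|B], t as [|B'];
  try discriminate; [reflexivity|].
simpl; intros E; f_equal; injection E; clear E; revert B'.
(* The inner induction follows the shape of [B]; at a leaf the outer recursion [F] applies to the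
   label. *)
induction B as [x|B1 IH1 B2 IH2]; intros [x'|B1' B2']; cbn [btree_map btree_code];
  intros E; apply to_nat_inj in E; try discriminate; injection E.
- intros Ex; f_equal; apply F, Ex.
- intros E2 E1; f_equal; auto.
Qed.

(** * The least ordinal that is not a value *)

Definition attained (c : Ord) : Prop := exists t, TB_val t == c.

Definition gap : Ord := omin (fun c => ~ attained c).

(** Otherwise the values of terms, indexed by the injective code, would enumerate all ordinals below
    [Omega]; numbers coding no term get an arbitrary ordinal. *)
Lemma exists_not_attained : exists c, c < Omega /\ ~ attained c.
Proof.
apply NNPP; intros Hn; apply Omega_uncountable.
exists (fun n => epsilon (inhabits ozero)
  (fun c => exists t, TB_code t = n /\ c = TB_val t)).
intros c Hc.
assert (Hatt : attained c) by (apply NNPP; intros H; apply Hn; now exists c).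
destruct Hatt as [t Ht]; exists (TB_code t).
destruct (epsilon_spec (inhabits ozero)
  (fun c => exists s, TB_code s = TB_code t /\ c = TB_val s)
  (ex_intro _ (TB_val t) (ex_intro _ t (conj eq_refl eq_refl)))) as [s [Hs E]].
rewrite E, (TB_code_inj Hs); exact Ht.
Qed.

Lemma gap_spec : gap < Omega /\ ~ attained gap /\ forall c, c < gap -> attained c.
Proof.
destruct exists_not_attained as [c [Hc Hnc]].
destruct (omin_spec (A := fun c => ~ attained c) Hnc) as [H1 H2].
split; [exact (ole_lt_trans (H2 c Hnc) Hc)|split; [exact H1|]].
intros d Hd; apply NNPP; intros H; exact (ole_not_lt (H2 d H) Hd).
Qed.

(** Embeddings both ways stand in for equality, because labels are attained only up to [==]; by
    [collapse_mono] they still give equal collapses. *)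
Lemma lift_labels (B : btree Ord) :
  (forall x, is_label x B -> attained x) ->
  exists B' : btree TB, btree_le ole B (btree_map TB_val B') /\
    btree_le ole (btree_map TB_val B') B.
Proof.
induction B as [x|B1 IH1 B2 IH2]; intros H.
- destruct (H x (is_label_leaf x)) as [t Ht]; exists (leaf t).
  destruct Ht; split; now constructor.
- destruct IH1 as [C1 []], IH2 as [C2 []]; try now (intros; apply H; constructor).
  exists (node C1 C2); split; now constructor.
Qed.

(* Otherwise take a counterexample [B] of minimal value: then [gap] satisfies
   the closure conditions defining [collapse B], hence is the value of the term
   with the shape of [B] whose labels denote those of [B]. *)
Lemma collapse_lt_gap (B : btree Ord) : labels_below B gap -> collapse B < gap.
Proof.
destruct gap_spec as [_ [Hna Hatt]].
induction B as [B IH] using (well_founded_ind tree_lt_wf); intros HB.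
apply not_ole_lt; intros Hge; apply Hna.
destruct (@lift_labels B) as [B' [H1 H2]].
{ intros x Hx; apply Hatt, HB, Hx. }
exists (circ_app B'); split; simpl.
- apply (ole_trans (collapse_mono H2)), collapse_le; now split.
- exact (ole_trans Hge (collapse_mono H1)).
Qed.

Lemma collapse_below_gap (B : btree Ord) :
  labels_below B gap -> collapse_bound B (collapse B).
Proof.
intros H; apply collapse_is_bound.
exact (olt_trans (collapse_lt_gap H) (proj1 gap_spec)).
Qed.

Lemma ozero_lt_gap : ozero < gap.
Proof.
apply not_ole_lt; intros H; apply (proj1 (proj2 gap_spec)).
exists circ; split; [apply ozero_le|exact H].
Qed.

(** The collapse of [leaf ozero] exceeds its label 0. The bound serves for the coefficient 1 in the
    codes of the tower. *)
Lemma oone_lt_gap : oone < gap.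
Proof.
assert (H : labels_below (leaf ozero) gap).
{ intros x Hx; inversion Hx; subst; exact ozero_lt_gap. }
refine (ole_lt_trans (oone_le _) (collapse_lt_gap H)).
apply (collapse_below_gap H); constructor.
Qed.

(** * A linear extension of length at least [gap] *)

(** The code breaks ties between terms of equal value: its injectivity gives antisymmetry, its
    monotonicity keeps the order an extension of [TB_le]. *)
Definition TB_order (s t : TB) : Prop :=
  TB_val s < TB_val t \/
  (TB_val s == TB_val t /\ (TB_code s <= TB_code t)%nat).

Lemma TB_order_extends : extends TB_order TB_le.
Proof.
intros s t H; destruct (ole_or_lt (TB_val t) (TB_val s)) as [H'|H'].
- right; split; [split; [now apply TB_val_mono|exact H']|now apply TB_code_mono].
- now left.
Qed.

Lemma TB_order_strict (s t : TB) : strict TB_order s t ->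
  TB_val s < TB_val t \/
  (TB_val s == TB_val t /\ (TB_code s < TB_code t)%nat).
Proof.
intros [[H|[H Hc]] Hne]; [now left|right; split; [exact H|]].
destruct (Nat.eq_dec (TB_code s) (TB_code t)) as [E|]; [|lia].
destruct (Hne (TB_code_inj E)).
Qed.

Lemma TB_order_wf : well_founded (strict TB_order).
Proof.
assert (H : forall a n t, TB_val t == a -> TB_code t = n ->
  Acc (strict TB_order) t); [|intros t; eauto using oeq_refl].
induction a as [a IHa] using olt_ind; induction n as [n IHn] using lt_wf_ind.
intros t Ht <-; constructor; intros s Hs.
destruct (TB_order_strict Hs) as [H|[H Hc]].
- exact (IHa _ (olt_le_trans H (proj1 Ht)) _ s (oeq_refl _) eq_refl).
- exact (IHn _ Hc s (oeq_trans H Ht) eq_refl).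
Qed.

Lemma TB_order_well_ordering : well_ordering TB_order.
Proof.
split.
- intros x; right; split; [apply oeq_refl|lia].
- intros x y [H|[H Hc]] [H'|[H' Hc']].
  + destruct (olt_irrefl (olt_trans H H')).
  + destruct (ole_not_lt (proj1 H') H).
  + destruct (ole_not_lt (proj1 H) H').
  + apply TB_code_inj; lia.
- intros x y z [H|[H Hc]] [H'|[H' Hc']].
  + left; exact (olt_trans H H').
  + left; exact (olt_le_trans H (proj1 H')).
  + left; exact (ole_lt_trans (proj1 H) H').
  + right; split; [exact (oeq_trans H H')|lia].
- intros x y.
  destruct (olt_or_oeq_or_gt (TB_val x) (TB_val y)) as [H|[H|H]].
  + left; now left.
  + destruct (Nat.le_ge_cases (TB_code x) (TB_code y)).
    * left; now right.
    * right; right; split; [now apply oeq_sym|assumption].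
  + right; now left.
- exact TB_order_wf.
Qed.

(** Every ordinal below [gap] is attained, so by induction a term of value [a < gap] has rank at
    least [a]. *)
Lemma gap_le_order_type (wo : well_ordering TB_order) : gap <= order_type wo.
Proof.
assert (Hrank : forall a t, TB_val t == a -> a < gap -> a <= rank (wo_wf wo) t).
{ induction a as [a IH] using olt_ind; intros t Ht Ha.
  apply ole_of_lt; intros c Hc.
  destruct (proj2 (proj2 gap_spec) c (olt_trans Hc Ha)) as [s Hs].
  apply (ole_lt_trans (IH c Hc s Hs (olt_trans Hc Ha))), rank_lt.
  assert (Hlt : TB_val s < TB_val t)
    by exact (ole_lt_trans (proj1 Hs) (olt_le_trans Hc (proj2 Ht))).
  split; [now left|intros ->; exact (olt_irrefl Hlt)]. }
apply ole_of_lt; intros c Hc.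
destruct (proj2 (proj2 gap_spec) c Hc) as [t Ht].
exists t; exact (Hrank c t Ht Hc).
Qed.

Lemma gap_le_max_order_type : gap <= max_order_type TB_le.
Proof.
pose (o := exist (fun R => well_ordering R /\ extends R TB_le) TB_order
  (conj TB_order_well_ordering TB_order_extends)).
exact (ole_trans (gap_le_order_type (proj1 (proj2_sig o)))
  (osup_ge (fun R => order_type (proj1 (proj2_sig R))) o)).
Qed.

(** * Coding ordinals below [epsilon_(Omega+1)] by trees *)

Lemma omul_ge_r (a b : Ord) : ozero < a -> b <= omul a b.
Proof.
intros Ha; induction b as [E g IH]; apply ole_intro; intros j.
apply (ole_lt_trans (IH j)).
refine (olt_le_trans _ (omul_step a (@elt_lt (ssup g) j))).
exact (ole_lt_trans (oadd_ge_l _ ozero) (oadd_lt_mono_r _ Ha)).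
Qed.

Lemma Omega_le_opow (a : Ord) : ozero < a -> Omega <= opow Omega a.
Proof.
intros Ha; refine (ole_trans _ (opow_step _ Ha)); apply omul_ge_r, opow_pos.
Qed.

Lemma opow_Omega_add_countable_lt (a b c : Ord) :
  c < Omega -> ozero < a -> a < b -> oadd (opow Omega a) c < opow Omega b.
Proof.
intros Hc Ha; apply opow_Omega_add_lt, (olt_le_trans Hc), Omega_le_opow, Ha.
Qed.

(** For [d' < d] the tree with leaves [c] and [d'] has smaller value and labels below the collapse,
    so by induction [oadd c d'] stays below it. *)
Lemma oadd_le_collapse (c d : Ord) :
  c < gap -> d < gap -> oadd c d <= collapse (node (leaf c) (leaf d)).
Proof.
intros Hc; induction d as [d IH] using olt_ind; intros Hd.
assert (H : labels_below (node (leaf c) (leaf d)) gap).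
{ intros x Hx; inversion Hx as [|? ? Hx'|? ? Hx']; subst;
    inversion Hx'; now subst. }
destruct (collapse_below_gap H) as [Hlab Hlt].
apply ole_of_lt; intros x Hx; destruct (olt_oadd Hx) as [Hxc|[d' [Hd' Hxd]]].
- apply (olt_trans Hxc), Hlab, is_label_left, is_label_leaf.
- apply (ole_lt_trans Hxd), (ole_lt_trans (IH d' Hd' (olt_trans Hd' Hd))), Hlt.
  + now apply oadd_lt_mono_r.
  + intros y Hy; inversion Hy as [|? ? Hy'|? ? Hy']; subst;
      inversion Hy'; subst.
    * apply Hlab, is_label_left, is_label_leaf.
    * apply (olt_trans Hd'), Hlab, is_label_right, is_label_leaf.
Qed.

(** For [c] and [d] below the collapse, [oadd c d] is at most the collapse of the tree with leaves
    [c] and [d]. The value [Omega ^ c + d] of that tree is below [Omega ^ Omega], so [collapse B] is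
    additively closed. *)
Lemma collapse_omega_power (B : btree Ord) :
  labels_below B gap -> opow Omega Omega <= tree_val B ->
  omega_power (collapse B).
Proof.
intros HB Hval.
assert (Hgap : forall c, c < collapse B -> c < gap).
{ intros c Hc; exact (olt_trans Hc (collapse_lt_gap HB)). }
assert (HOm : forall c, c < gap -> c < Omega).
{ intros c Hc; exact (olt_trans Hc (proj1 gap_spec)). }
destruct (collapse_below_gap HB) as [Hlab Hlt].
apply additively_closed_omega_power.
- assert (Hx : exists x, is_label x B).
  { clear; induction B as [x|B1 [x Hx] B2 _];
      exists x; [constructor|now constructor]. }
  destruct Hx as [x Hx]; exact (ole_lt_trans (ozero_le x) (Hlab x Hx)).
- intros c d Hc Hd.
  apply (ole_lt_trans (oadd_le_collapse (Hgap c Hc) (Hgap d Hd))), Hlt.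
  + refine (olt_le_trans _ Hval).
    apply ole_lt_trans with (oadd (opow Omega (osucc c)) d).
    (* Passing to the successor of [c] makes the exponent positive, so that its power absorbs the
       countable [d] even when [c] is zero. *)
    * exact (oadd_mono (opow_mono _ (olt_le (osucc_gt c))) (ole_refl d)).
    * apply opow_Omega_add_countable_lt; auto using osucc_lt_Omega.
      exact (ole_lt_trans (ozero_le c) (osucc_gt c)).
  + intros x Hx; inversion Hx as [|? ? Hx'|? ? Hx']; subst;
      inversion Hx'; now subst.
Qed.

(* The code of [ozero]: its value, at least [Omega ^ Omega], makes the collapse
   of every code additively closed. *)
Definition tree_base : btree Ord :=
  node (node (node (leaf ozero) (leaf ozero)) (leaf ozero)) (leaf ozero).

(** The base value is [f (f (f 0))] with [f x = Omega ^ x + 0], and [x < f x] propagates through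
    [f]. This puts the code of 0 below the codes of positive ordinals. *)
Lemma tree_val_base_lt : tree_val tree_base < opow Omega (tree_val tree_base).
Proof.
pose (f := fun x => oadd (opow Omega x) ozero).
assert (step : forall x y, x < y -> f x < opow Omega y).
{ intros x y; apply opow_Omega_add_lt, opow_pos. }
assert (mono : forall x, x < f x -> f x < f (f x)).
{ intros x Hx; exact (olt_le_trans (step _ _ Hx) (oadd_ge_l _ _)). }
change (f (f (f ozero)) < opow Omega (f (f (f ozero)))).
apply step, mono, mono.
exact (olt_le_trans (opow_pos _ _) (oadd_ge_l _ _)).
Qed.

Lemma tree_val_base_ge : opow Omega Omega <= tree_val tree_base.
Proof.
refine (ole_trans _ (oadd_ge_l _ _)); apply opow_mono.
refine (ole_trans _ (oadd_ge_l _ _)); apply Omega_le_opow.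
exact (olt_le_trans (opow_pos _ _) (oadd_ge_l _ _)).
Qed.

Lemma is_label_base (x : Ord) : is_label x tree_base -> x = ozero.
Proof.
intros H; repeat match goal with
  | H : is_label _ _ |- _ => inversion H; subst; clear H end; reflexivity.
Qed.

(* [code b B]: the normal form [b = Omega ^ e * c + r], iterated hereditarily,
   is written in [B] with the coefficients as labels. *)
Inductive code : Ord -> btree Ord -> Prop :=
| code_zero b : b == ozero -> code b tree_base
| code_term b e c r A R :
    b == oadd (omul (opow Omega e) c) r ->
    ozero < c -> c < Omega -> r < opow Omega e -> e < b ->
    code e A -> code r R -> code b (node (node A (leaf c)) R).

Lemma code_oeq (b b' : Ord) (B : btree Ord) : b == b' -> code b B -> code b' B.
Proof.
intros E H; inversion H as [? E0|? e c r A R Eb Hc HcO Hr He HA HR]; subst.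
- apply code_zero, (oeq_trans (oeq_sym E) E0).
- apply (@code_term b' e c r); auto.
  + exact (oeq_trans (oeq_sym E) Eb).
  + exact (olt_le_trans He (proj1 E)).
Qed.

(** * Lexicographic comparison of leading terms *)

Lemma term_ge (e c r : Ord) :
  ozero < c -> opow Omega e <= oadd (omul (opow Omega e) c) r.
Proof. intros Hc; exact (ole_trans (omul_pos _ Hc) (oadd_ge_l _ _)). Qed.

Lemma term_pos (e c r : Ord) :
  ozero < c -> ozero < oadd (omul (opow Omega e) c) r.
Proof. intros Hc; exact (olt_le_trans (opow_pos _ _) (term_ge e r Hc)). Qed.

Lemma term_lt_coef (e c c' r : Ord) :
  r < opow Omega e -> c < c' ->
  oadd (omul (opow Omega e) c) r < omul (opow Omega e) c'.
Proof.
intros Hr Hc; exact (olt_le_trans (oadd_lt_mono_r _ Hr) (omul_step _ Hc)).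
Qed.

Lemma term_lt_opow (e e' c r : Ord) :
  c < Omega -> r < opow Omega e -> e < e' ->
  oadd (omul (opow Omega e) c) r < opow Omega e'.
Proof.
intros Hc Hr He; exact (olt_le_trans (term_lt_coef Hr Hc) (opow_step _ He)).
Qed.

Lemma term_mono (e e' c c' r r' : Ord) : e <= e' -> c <= c' -> r <= r' ->
  oadd (omul (opow Omega e) c) r <= oadd (omul (opow Omega e') c') r'.
Proof.
intros He Hc Hr; apply oadd_mono; [|exact Hr].
apply omul_mono; [now apply opow_mono|exact Hc].
Qed.

Section Terms.

Variables e c r e' c' r' : Ord.
Hypothesis (Hc : ozero < c) (HcO' : c' < Omega) (Hr' : r' < opow Omega e').

Let b := oadd (omul (opow Omega e) c) r.
Let b' := oadd (omul (opow Omega e') c') r'.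

(** A larger coefficient outweighs any remainder below the power, and a larger exponent outweighs
    any coefficient below [Omega]. *)
Lemma term_le_inv :
  b <= b' -> e < e' \/ (e == e' /\ c < c') \/ (e == e' /\ c == c' /\ r <= r').
Proof.
intros H; destruct (olt_or_oeq_or_gt e e') as [He|[He|He]]; [now left| |].
- right; destruct (olt_or_oeq_or_gt c c') as [Hcc|[Hcc|Hcc]]; [now left| |].
  + right; split; [exact He|split; [exact Hcc|]].
    apply not_olt_le; intros Hrr; apply (ole_not_lt H).
    refine (ole_lt_trans _ (oadd_lt_mono_r _ Hrr)).
    exact (term_mono (proj2 He) (proj2 Hcc) (ole_refl _)).
  + destruct (ole_not_lt H).
    apply (olt_le_trans (term_lt_coef Hr' Hcc)), (ole_trans (oadd_ge_l _ r)).
    exact (term_mono (proj2 He) (ole_refl _) (ole_refl _)).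
- destruct (ole_not_lt H).
  exact (olt_le_trans (term_lt_opow HcO' Hr' He) (term_ge e r Hc)).
Qed.

Lemma term_lt_inv :
  b < b' -> e < e' \/ (e == e' /\ c < c') \/ (e == e' /\ c == c' /\ r < r').
Proof.
intros H; destruct (term_le_inv (olt_le H)) as [Q|[Q|[Qe [Qc _]]]]; [tauto..|].
right; right; split; [exact Qe|split; [exact Qc|]].
apply not_ole_lt; intros Hrr; apply (fun h => ole_not_lt h H).
exact (term_mono (proj2 Qe) (proj2 Qc) Hrr).
Qed.

End Terms.

Lemma term_oeq_inv (e c r e' c' r' : Ord) :
  ozero < c -> c < Omega -> r < opow Omega e ->
  ozero < c' -> c' < Omega -> r' < opow Omega e' ->
  oadd (omul (opow Omega e) c) r == oadd (omul (opow Omega e') c') r' ->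
  e == e' /\ c == c' /\ r == r'.
Proof.
intros Hc HcO Hr Hc' HcO' Hr' [H H'].
destruct (term_le_inv Hc HcO' Hr' H) as [Q|[[Qe Qc]|[Qe [Qc Qr]]]];
destruct (term_le_inv Hc' HcO Hr H') as [Q'|[[Qe' Qc']|[Qe' [Qc' Qr']]]];
match goal with
| h : ?x < ?y, k : ?y < ?x |- _ => destruct (olt_irrefl (olt_trans h k))
| h : ?x < ?y, k : ?x == ?y |- _ => destruct (ole_not_lt (proj2 k) h)
| h : ?x < ?y, k : ?y == ?x |- _ => destruct (ole_not_lt (proj1 k) h)
| _ => now repeat split; try first [apply Qe | apply Qc]
end.
Qed.

Lemma code_base_le (b : Ord) (B : btree Ord) :
  code b B -> tree_val tree_base <= tree_val B.
Proof.
induction 1 as [b E|b e c r A R E Hc HcO Hr He HA IHA HR IHR].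
- apply ole_refl.
- exact (ole_trans IHR (oadd_ge_r _ _)).
Qed.

Lemma code_Omega_le (b : Ord) (B : btree Ord) :
  code b B -> opow Omega Omega <= tree_val B.
Proof. intros H; exact (ole_trans tree_val_base_ge (code_base_le H)). Qed.

Lemma code_val_pos (b : Ord) (B : btree Ord) : code b B -> ozero < tree_val B.
Proof. intros H; exact (olt_le_trans (opow_pos _ _) (code_Omega_le H)). Qed.

Lemma tree_base_lt_opow (a : Ord) (A : btree Ord) (c : Ord) :
  code a A ->
  tree_val tree_base < opow Omega (oadd (opow Omega (tree_val A)) c).
Proof.
intros HA; apply (olt_le_trans tree_val_base_lt), opow_mono.
apply (ole_trans (code_base_le HA)), (ole_trans (opow_ge oone_lt_Omega _)).
apply oadd_ge_l.
Qed.

(* The second conjunct says that the value of a tail is small compared to the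
   term in front of it; it is what makes the comparison lexicographic. *)
Lemma code_tree_val (b : Ord) (B : btree Ord) : code b B ->
  (forall b' B', code b' B' ->
     (b <= b' -> tree_val B <= tree_val B') /\
     (b < b' -> tree_val B < tree_val B')) /\
  (forall e A c, code e A -> b < opow Omega e ->
     tree_val B < opow Omega (oadd (opow Omega (tree_val A)) c)).
Proof.
induction 1 as [b E|b e c r A R E Hc HcO Hr He HA [IHA _] HR [IHR IHR']].
- split.
  + intros b' B' HB'; split; intros Hb; [exact (code_base_le HB')|].
    inversion HB' as [? E0|? e' c' r' A' R' E' Hc' HcO' Hr' He' HA' HR']; subst.
    * destruct (@not_olt_ozero b (olt_le_trans Hb (proj1 E0))).
    * exact (olt_le_trans (tree_base_lt_opow _ HA') (oadd_ge_l _ _)).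
  + intros e A c HA _; exact (tree_base_lt_opow c HA).
(* Writing [A] and [R] for their values, the code has value [Omega ^ (Omega ^ A + c) + R]; in the
   outer exponent, an increase of [A] absorbs any coefficient below [Omega]. *)
- assert (Hexp : forall e' A' c', code e' A' -> e < e' ->
    oadd (opow Omega (tree_val A)) c < oadd (opow Omega (tree_val A')) c').
  { intros e' A' c' HA' Hee'; refine (olt_le_trans _ (oadd_ge_l _ _)).
    apply opow_Omega_add_countable_lt; [exact HcO|exact (code_val_pos HA)|].
    now apply (IHA _ _ HA'). }
  assert (Htail : forall p',
    oadd (opow Omega (tree_val A)) c < p' ->
    tree_val (node (node A (leaf c)) R) < opow Omega p').
  { intros p' Hp'; simpl; apply opow_Omega_add_lt; [|exact Hp'].
    exact (IHR' e A c HA Hr). }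
  split.
  + intros b' B' HB'.
    inversion HB' as [? E0|? e' c' r' A' R' E' Hc' HcO' Hr' He' HA' HR']; subst.
    { assert (Hb : b' < b).
      { apply (ole_lt_trans (proj1 E0)).
        exact (olt_le_trans (term_pos e r Hc) (proj2 E)). }
      split; intros Hb'; [destruct (ole_not_lt Hb' Hb)|].
      destruct (olt_irrefl (olt_trans Hb Hb')). }
    (* Either difference raises [Omega ^ A + c] strictly, and [Htail] then dominates the tail
       [R]. *)
    assert (Hdiff : e < e' \/ (e == e' /\ c < c') ->
      tree_val (node (node A (leaf c)) R) <
      tree_val (node (node A' (leaf c')) R')).
    { intros H; refine (olt_le_trans _ (oadd_ge_l _ _)); apply Htail.
      destruct H as [H|[H H']]; [now apply (Hexp e')|].
      apply (@ole_lt_trans _ (oadd (opow Omega (tree_val A')) c));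
        [|now apply oadd_lt_mono_r].
      apply oadd_mono; [|apply ole_refl].
      apply opow_mono, (IHA _ _ HA'), H. }
    assert (Hsame : e == e' -> c == c' ->
      oadd (opow Omega (tree_val A)) c <= oadd (opow Omega (tree_val A')) c').
    { intros H H'; apply oadd_mono; [|apply H'].
      apply opow_mono, (IHA _ _ HA'), H. }
    split; intros Hb.
    * destruct (term_le_inv (e := e) (r := r) Hc HcO' Hr')
        as [Q|[Q|[Qe [Qc Qr]]]]; try (apply olt_le, Hdiff; tauto).
      { exact (ole_trans (proj2 E) (ole_trans Hb (proj1 E'))). }
      simpl; apply oadd_mono; [now apply opow_mono, Hsame|].
      now apply (IHR _ _ HR').
    * destruct (term_lt_inv (e := e) (r := r) Hc HcO' Hr')
        as [Q|[Q|[Qe [Qc Qr]]]]; try (apply Hdiff; tauto).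
      { exact (ole_lt_trans (proj2 E) (olt_le_trans Hb (proj1 E'))). }
      apply (@ole_lt_trans _ (tree_val (node (node A' (leaf c')) R))).
      -- simpl; apply oadd_mono; [now apply opow_mono, Hsame|apply ole_refl].
      -- simpl; apply oadd_lt_mono_r; now apply (IHR _ _ HR').
  + intros e' A' c' HA' Hb; apply Htail, (Hexp e'); [exact HA'|].
    apply (opow_lt_inv (w := Omega)); refine (ole_lt_trans _ Hb).
    exact (ole_trans (term_ge e r Hc) (proj2 E)).
Qed.

(** * The labels of the code of [b] are the elements of [K b] *)

Lemma Omega_sum_lt (l : list (Ord * Ord)) (e : Ord) :
  Forall (fun p => ozero < snd p /\ snd p < Omega) l ->
  Sorted (fun x y => y < x) (e :: map fst l) ->
  Omega_sum l < opow Omega e.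
Proof.
revert e; induction l as [|[e1 c1] l IH]; intros e HF HS; simpl.
- apply opow_pos.
- apply Sorted_inv in HS as [HS He]; apply HdRel_inv in He.
  inversion HF as [|? ? [_ Hc] HF']; subst.
  apply term_lt_opow; [exact Hc|now apply IH|exact He].
Qed.

Lemma code_nf (b : Ord) (B : btree Ord) : code b B ->
  exists l, is_Omega_nf b l /\ inK b ozero /\
    forall y, is_label y B -> y = ozero \/
      exists e c, In (e, c) l /\ (y == c \/ inK e y).
Proof.
induction 1 as [b E|b e c r A R E Hc HcO Hr He HA IHA HR IHR].
- exists nil; split; [|split].
  + split; [exact E|split; [constructor|repeat constructor]].
  + apply inK_zero; [exact E|apply oeq_refl].
  + intros y Hy; left; exact (is_label_base Hy).
- destruct IHA as [lA [HlA [HA0 HAl]]], IHR as [l [[El [HF HS]] [_ HRl]]].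
  assert (Hnf : is_Omega_nf b ((e, c) :: l)).
  { split; [|split].
    - apply (oeq_trans E); split; simpl;
        (apply oadd_mono; [apply ole_refl|apply El]).
    - now constructor.
    - simpl; constructor; [constructor|now constructor].
      + exact (proj1 (Sorted_inv HS)).
      + destruct l as [|[e1 c1] l]; simpl; constructor.
        apply (opow_lt_inv (w := Omega)); refine (ole_lt_trans _ Hr).
        apply ole_trans with (Omega_sum ((e1, c1) :: l)); [|apply El].
        apply term_ge; now inversion HF as [|? ? []]. }
  exists ((e, c) :: l); split; [exact Hnf|split].
  + apply (inK_exp Hnf (or_introl eq_refl)), HA0.
  + intros y Hy; inversion Hy as [|? ? Hy'|? ? Hy']; subst.
    * right; exists e, c; split; [now left|].
      inversion Hy' as [|? ? Hy''|? ? Hy'']; subst.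
      -- right; destruct (HAl y Hy'') as [->|[e1 [c1 [Hin [Hyc|HyK]]]]].
         ++ exact HA0.
         ++ exact (inK_coef HlA Hin Hyc).
         ++ exact (inK_exp HlA Hin HyK).
      -- left; inversion Hy''; apply oeq_refl.
    * destruct (HRl y Hy') as [Hy0|[e1 [c1 [Hin Hy1]]]]; [now left|].
      right; exists e1, c1; split; [now right|exact Hy1].
Qed.

Lemma code_label_inK (b y : Ord) (B : btree Ord) :
  code b B -> is_label y B -> inK b y.
Proof.
intros HB Hy; destruct (code_nf HB) as [l [Hl [H0 HK]]].
destruct (HK y Hy) as [->|[e [c [Hin [Hyc|HyK]]]]].
- exact H0.
- exact (inK_coef Hl Hin Hyc).
- exact (inK_exp Hl Hin HyK).
Qed.

(** Uniqueness of the leading term matches any normal form with the code, term by term. Sortedness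
    of the exponents alone passes to the tail without comparing them with [r]. *)
Lemma code_nf_unique (l : list (Ord * Ord)) (b : Ord) (B : btree Ord) :
  code b B -> b == Omega_sum l ->
  Forall (fun p => ozero < snd p /\ snd p < Omega) l ->
  Sorted (fun x y => y < x) (map fst l) ->
  forall e c, In (e, c) l ->
    (exists y, is_label y B /\ c == y) /\
    exists A, code e A /\ forall y, is_label y A -> is_label y B.
Proof.
revert b B; induction l as [|[e1 c1] l IH]; intros b B HB Eb HF HS e c Hin;
  [destruct Hin|].
inversion HF as [|? ? [Hc1 HcO1] HF']; subst; simpl in *.
inversion HB as [? E0|? e' c' r' A R E' Hc' HcO' Hr' He' HA HR]; subst.
{ destruct (@not_olt_ozero ozero).
  apply (olt_le_trans (term_pos e1 (Omega_sum l) Hc1)).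
  exact (ole_trans (proj2 Eb) (proj1 E0)). }
destruct (term_oeq_inv Hc' HcO' Hr' Hc1 HcO1 (Omega_sum_lt HF' HS)
  (oeq_trans (oeq_sym E') Eb)) as [Ee [Ec Er]].
destruct Hin as [Hin|Hin].
- injection Hin as <- <-; split.
  + exists c'; split; [apply is_label_left, is_label_right, is_label_leaf|].
    exact (oeq_sym Ec).
  + exists A; split; [exact (code_oeq Ee HA)|].
    intros y Hy; now apply is_label_left, is_label_left.
- destruct (IH r' R HR Er HF' (proj1 (Sorted_inv HS)) e c Hin)
    as [[y [Hy Hcy]] [A' [HA' HyA']]]; split.
  + exists y; split; [now apply is_label_right|exact Hcy].
  + exists A'; split; [exact HA'|]; intros z Hz; apply is_label_right, HyA', Hz.
Qed.

Lemma inK_code_label (b x : Ord) : inK b x ->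
  forall B, code b B -> exists y, is_label y B /\ x == y.
Proof.
induction 1 as [b x Eb Ex|b l e c x [El [HF HS]] Hin Ex
  |b l e c x [El [HF HS]] Hin _ IH]; intros B HB.
- inversion HB as [? E0|? e' c' r' A R E' Hc' HcO' Hr' He' HA HR]; subst.
  + exists ozero; split; [apply is_label_right, is_label_leaf|exact Ex].
  + destruct (@not_olt_ozero ozero).
    apply (olt_le_trans (term_pos e' r' Hc')).
    exact (ole_trans (proj2 E') (proj1 Eb)).
- destruct (code_nf_unique HB El HF (proj1 (Sorted_inv HS)) Hin)
    as [[y [Hy Hcy]] _].
  exists y; split; [exact Hy|exact (oeq_trans Ex Hcy)].
- destruct (code_nf_unique HB El HF (proj1 (Sorted_inv HS)) Hin)
    as [_ [A [HA HAB]]].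
  destruct (IH A HA) as [y [Hy Hxy]]; eauto.
Qed.

Lemma greatest_label (B : btree Ord) :
  exists m, is_label m B /\ forall x, is_label x B -> x <= m.
Proof.
induction B as [x|B1 [m1 [Hm1 H1]] B2 [m2 [Hm2 H2]]].
- exists x; split; [constructor|]; intros y Hy; inversion Hy; apply ole_refl.
- destruct (ole_or_lt m1 m2) as [H|H].
  + exists m2; split; [now apply is_label_right|].
    intros x Hx; inversion Hx; subst; eauto using ole_trans.
  + exists m1; split; [now apply is_label_left|].
    intros x Hx; inversion Hx; subst; eauto using ole_trans, olt_le.
Qed.

(** Up to [==], the labels of a code are exactly the elements of [K b]; a finite tree has a greatest
    label, so the maximum in [maxK] exists. *)
Lemma maxK_lt_iff (b z : Ord) (B : btree Ord) :
  code b B -> maxK b < z <-> labels_below B z.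
Proof.
intros HB.
assert (Hmax : inK b (maxK b) /\ forall x, inK b x -> x <= maxK b).
{ apply (epsilon_spec (inhabits ozero)
    (fun a => inK b a /\ forall x, inK b x -> x <= a)).
  destruct (greatest_label B) as [m [Hm Hmax]].
  exists m; split; [exact (code_label_inK HB Hm)|].
  intros x Hx; destruct (inK_code_label Hx HB) as [y [Hy Hxy]].
  exact (ole_trans (proj1 Hxy) (Hmax y Hy)). }
destruct Hmax as [Hin Hmax]; split; intros H.
- intros x Hx; exact (ole_lt_trans (Hmax x (code_label_inK HB Hx)) H).
- destruct (inK_code_label Hin HB) as [y [Hy Hxy]].
  exact (ole_lt_trans (proj1 Hxy) (H y Hy)).
Qed.

(** * Every ordinal below the tower has a code *)

(** If [b] lies between two consecutive levels, then [b < Omega ^ Omega_tower n oone <= Omega ^ b].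
    This makes the leading exponent of [b] smaller than [b]. *)
Lemma opow_tower_bound (n : nat) (b : Ord) :
  b < Omega_tower n oone -> b < opow Omega b.
Proof.
revert b; induction n as [|n IH]; simpl; intros b Hb.
- exact (olt_le_trans Hb (oone_le_opow _ _)).
- destruct (ole_or_lt (Omega_tower n oone) b) as [H|H]; [|now apply IH].
  exact (olt_le_trans Hb (opow_mono _ H)).
Qed.

(** Division with remainder: the least [e'] with [b < Omega ^ e'] lies just above the exponent [e],
    the least [c] with [b < Omega ^ e * c + Omega ^ e] is the coefficient, and left subtraction
    gives [r]. *)
Lemma leading_term (b : Ord) : ozero < b ->
  exists e c r, b == oadd (omul (opow Omega e) c) r /\
    ozero < c /\ c < Omega /\ r < opow Omega e.
Proof.
intros Hb.
destruct (@least_ordinal (fun e => b < opow Omega e) (osucc b))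
  as [e' [He' Hmin]].
{ exact (ole_lt_trans (opow_ge oone_lt_Omega b)
    (opow_lt oone_lt_Omega (osucc_gt b))). }
destruct (olt_opow He') as [H|[e [He H]]].
{ destruct (ole_not_lt (oone_le Hb) H). }
assert (Hle : opow Omega e <= b).
{ apply not_olt_le; intros Hlt; exact (ole_not_lt (Hmin e Hlt) He). }
destruct (olt_omul H) as [d [Hd Hbd]].
destruct (@least_ordinal
  (fun c => b < oadd (omul (opow Omega e) c) (opow Omega e)) d)
  as [c [Hbc Hcmin]]; [exact Hbd|].
assert (Hcb : omul (opow Omega e) c <= b).
{ apply ole_of_lt; intros x Hx; destruct (olt_omul Hx) as [y [Hy Hxy]].
  apply (olt_le_trans Hxy), not_olt_le; intros Hlt.
  exact (ole_not_lt (Hcmin y Hlt) Hy). }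
destruct (oadd_diff Hcb) as [r Er].
exists e, c, r; split; [exact Er|split; [|split]].
- apply not_ole_lt; intros Hc; apply (ole_not_lt Hle), (olt_le_trans Hbc).
  refine (ole_trans _ (@ozero_oadd _)); apply oadd_mono; [|apply ole_refl].
  apply ole_of_lt; intros x Hx; destruct (olt_omul Hx) as [y [Hy _]].
  destruct (not_olt_ozero (olt_le_trans Hy Hc)).
- exact (ole_lt_trans (Hcmin d Hbd) Hd).
- apply not_ole_lt; intros Hr; apply (fun h => ole_not_lt h Hbc).
  refine (ole_trans _ (proj2 Er)); apply oadd_mono; [apply ole_refl|exact Hr].
Qed.

Lemma code_exists (n : nat) (b : Ord) :
  b < Omega_tower n oone -> exists B, code b B.
Proof.
induction b as [b IH] using olt_ind; intros Hb.
destruct (ole_or_lt b ozero) as [H0|Hpos].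
{ exists tree_base; apply code_zero; split; [exact H0|apply ozero_le]. }
destruct (leading_term Hpos) as [e [c [r [E [Hc [HcO Hr]]]]]].
assert (Hle : opow Omega e <= b).
{ exact (ole_trans (term_ge e r Hc) (proj2 E)). }
assert (Heb : e < b).
{ apply (opow_lt_inv (w := Omega)).
  exact (ole_lt_trans Hle (opow_tower_bound Hb)). }
assert (Hrb : r < b) by exact (olt_le_trans Hr Hle).
destruct (IH e Heb (olt_trans Heb Hb)) as [A HA].
destruct (IH r Hrb (olt_trans Hrb Hb)) as [R HR].
exists (node (node A (leaf c)) R); now apply (@code_term b e c r).
Qed.

Lemma Omega_tower_lt (n : nat) :
  Omega_tower n oone < Omega_tower (S n) oone.
Proof.
induction n as [|n IH]; [|exact (opow_lt oone_lt_Omega IH)].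
exact (olt_le_trans oone_lt_Omega (Omega_le_opow (osucc_gt _))).
Qed.

Lemma code_opow (e : Ord) (A : btree Ord) : e < opow Omega e -> code e A ->
  code (opow Omega e) (node (node A (leaf oone)) tree_base).
Proof.
intros He HA; apply (@code_term _ e oone ozero); try assumption.
- split.
  + apply term_ge, osucc_gt.
  + exact (ole_trans (@oadd_zero _) (@omul_one_le _)).
- apply osucc_gt.
- exact oone_lt_Omega.
- apply opow_pos.
- apply code_zero, oeq_refl.
Qed.

Lemma opow_zero_le (a : Ord) : opow a ozero <= oone.
Proof. apply osup_le; intros [[]|]; apply ole_refl. Qed.

Lemma code_tower (n : nat) :
  exists B, code (Omega_tower n oone) B /\ labels_below B gap.
Proof.
assert (Hlab : forall A, labels_below A gap ->
  labels_below (node (node A (leaf oone)) tree_base) gap).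
{ intros A HA x Hx; inversion Hx as [|? ? Hx'|? ? Hx']; subst;
    [inversion Hx' as [|? ? Hx''|? ? Hx'']; subst|].
  - exact (HA x Hx'').
  - inversion Hx''; exact oone_lt_gap.
  - rewrite (is_label_base Hx'); exact ozero_lt_gap. }
induction n as [|n [B [HB HBlab]]].
(* Here 1 is read as [Omega ^ 0] with coefficient 1. *)
- exists (node (node tree_base (leaf oone)) tree_base); split.
  + apply (@code_oeq (opow Omega ozero)).
    * split; [apply opow_zero_le|apply oone_le_opow].
    * apply code_opow; [apply opow_pos|apply code_zero, oeq_refl].
  + apply Hlab; intros x Hx; rewrite (is_label_base Hx); exact ozero_lt_gap.
- exists (node (node B (leaf oone)) tree_base); split; [|now apply Hlab].
  apply code_opow; [apply Omega_tower_lt|exact HB].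
Qed.

(** * Comparison of [theta] with the collapse *)

Lemma theta_eq (a : Ord) :
  theta a = omin (fun z => omega_power z /\ maxK a < z /\
    forall b, b < a -> maxK b < z -> theta b < z).
Proof.
unfold theta at 1; rewrite Fix_eq; [reflexivity|].
intros b f g H; replace g with f; [reflexivity|].
apply functional_extensionality_dep; intros y.
apply functional_extensionality_dep; intros p; apply H.
Qed.

(** [collapse B] satisfies the three conditions whose least solution is [theta b]: for the third, a
    smaller [b'] with code [B'] has [theta b' <= collapse B' < collapse B]. *)
Lemma theta_le_collapse (n : nat) (b : Ord) : b < Omega_tower n oone ->
  forall B, code b B -> labels_below B gap -> theta b <= collapse B.
Proof.
induction b as [b IH] using olt_ind; intros Hb B HB HBgap.
destruct (collapse_below_gap HBgap) as [Hlab Hlt].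
rewrite theta_eq; apply omin_le; split; [|split].
- exact (collapse_omega_power HBgap (code_Omega_le HB)).
- exact (proj2 (maxK_lt_iff _ HB) Hlab).
- intros b' Hb' HK.
  destruct (code_exists (olt_trans Hb' Hb)) as [B' HB'].
  pose proof (proj1 (maxK_lt_iff _ HB') HK) as Hlab'.
  apply ole_lt_trans with (collapse B').
  + apply (IH b' Hb' (olt_trans Hb' Hb) B' HB').
    (* The labels of [B'] are below [collapse B], which is itself below [gap]. *)
    intros x Hx; exact (olt_trans (Hlab' x Hx) (collapse_lt_gap HBgap)).
  + apply Hlt; [|exact Hlab'].
    exact (proj2 (proj1 (code_tree_val HB') b B HB) Hb').
Qed.

Theorem theorem4p3 : (Howard_Bachmann <= max_order_type TB_le)%ord.
Proof.
refine (ole_trans _ gap_le_max_order_type); apply osup_le; intros n.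
destruct (code_tower n) as [B [HB HBgap]].
apply olt_le.
exact (ole_lt_trans (theta_le_collapse (Omega_tower_lt n) HB HBgap)
  (collapse_lt_gap HBgap)).
Qed.
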